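(* Let $n = p_1^{\alpha_1}\cdots p_r^{\alpha_r}$ be the prime factorisation of a positive integer $n$ (distinct primes, $\alpha_i>0$), and let $e_1 \mid e_2 \mid \dots \mid e_n$ be the elementary divisors of $A_n$; put $e_0 = 1$. Then: (1) the $n$-tuple $\left(e_1, \frac{e_2}{e_1}, \dots, \frac{e_n}{e_{n-1}}\right)$ is a permutation of the $n$-tuple consisting of $p_1$ repeated $\alpha_1$ times, $p_2$ repeated $\alpha_2$ times, $\dots$, $p_r$ repeated $\alpha_r$ times, and $1$ repeated $n - \sum_i \alpha_i$ times; (2) for $1\le j\le n$ and $1 \le i \le r$, the ratio $e_j/e_{j-1}$ equals $p_i$ if and only if $j = n - \frac{n}{p_i^t} + 1$ for some integer $t$ with $1 \le t \le \alpha_i$.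
   Context: For a positive integer $k$, let $\Phi_d$ denote the $d$th cyclotomic polynomial and let $\Psi_k : \mathbf{Z}[X]/(X^k-1) \to \bigoplus_{d \mid k} \mathbf{Z}[X]/(\Phi_d(X))$ be the natural map $f \bmod (X^k-1) \mapsto \bigoplus_{d\mid k} f \bmod \Phi_d(X)$, with bases $(1,\overline{X},\dots,\overline{X}^{k-1})$ on the domain, $(1,\overline{X},\dots,\overline{X}^{\phi(d)-1})$ on each summand, summands ordered by increasing $d$; $A_k$ is the matrix of $\Psi_k$ in these bases. Elementary divisors are those of the Smith normal form over $\mathbf{Z}$, taken non-negative. *)

(* Defs.v *)
From HB Require Import structures.
From mathcomp Require Import all_boot all_order all_algebra all_field.
Set Implicit Arguments. Unset Strict Implicit. Unset Printing Implicit Defensive.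
Import GRing.Theory Num.Theory.
Local Open Scope ring_scope.

(* Row index bookkeeping for A_k: the codomain basis is the concatenation, over
   the divisors d of k in increasing order ([divisors k] is sorted), of the
   bases (1, X, ..., X^(phi(d)-1)) of Z[X]/(Phi_d).  Row number r corresponds
   to the pair (d, i) = nth (0,0) (row_labels k) r, meaning the coefficient of
   X^i in the reduction modulo Phi_d. *)
Definition row_labels (k : nat) : seq (nat * nat) :=
  flatten [seq [seq (d, i) | i <- iota 0 (totient d)] | d <- divisors k].

(* A_k: the matrix of Psi_k.  Column j is the image of X^j (j < k); its entry in
   row (d, i) is the i-th coefficient of X^j mod Phi_d (Phi_d monic, so %% is
   exact Euclidean division in Z[X]).  sum_{d | k} phi(d) = k, so A_k is k x k. *)
Definition Amat (k : nat) : 'M[int]_k :=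
  \matrix_(r < k, j < k)
    let: (d, i) := nth (0%N, 0%N) (row_labels k) r in
    (('X^j %% 'Phi_d : {poly int})`_i).

Definition elementary_divisors (k : nat) (M : 'M[int]_k) (e : seq nat) : Prop :=
  [/\ size e = k, sorted dvdn e &
   exists2 L : 'M[int]_k, L \in unitmx &
   exists2 R : 'M[int]_k, R \in unitmx &
     M = L *m (\matrix_(i, j) ((nth 0%N e i)%:Z *+ (i == j :> nat))) *m R].

(* e_j / e_{j-1}, with e_0 = 1, for 1 <= j; here e = [e_1; ...; e_k]. *)
Definition ed_ratio (e : seq nat) (j : nat) : nat :=
  nth 1%N (1%N :: e) j %/ nth 1%N (1%N :: e) j.-1.

(* Main.v *)
(** Fix a prime p and write n = p^a m with p not dividing m.  The number of
    elementary divisors of A_n divisible by p^t is the dimension over F_p of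
    N_t = { g mod p : Psi_n(g) = 0 mod p^t }.

    Put k = n/p^t with t <= a, and F = (X^n - 1)/(X^k - 1).  Then F vanishes
    modulo Phi_d for d | n not dividing k, and F = p^t modulo X^k - 1, so N_t
    contains the k independent elements F X^i with i < k.

    Conversely, let G_0 = X^m - 1 and
    G_s = (X^(m p^s) - 1)/(X^(m p^(s-1)) - 1) = prod_(d | m) Phi_(d p^s).
    For fixed s these Phi_(d p^s) are pairwise comaximal up to an integer prime
    to p, so Psi_n(g) = 0 mod p^t puts g in every ideal (p^t, G_s).  Since G_s = p
    modulo G_i for i < s, dividing successively by G_a, G_(a-1), ... gives
    g in (p, G_a G_(a-1) ... G_(a-t+1)), and that product is F if t <= a and
    X^n - 1 if t = a+1.  Hence dim N_t = n/p^t for t <= a, and N_(a+1) = 0. *)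
Require Import Defs.
From HB Require Import structures.
From mathcomp Require Import all_boot all_order all_algebra all_field.
From mathcomp Require Import cyclic zify ring.
Set Implicit Arguments. Unset Strict Implicit. Unset Printing Implicit Defensive.
Import GRing.Theory Num.Theory.
Local Open Scope ring_scope.

(** * Ideals (a, b) and comaximality away from p *)

Definition in_ideal2 (R : comNzRingType) (a b g : R) :=
  exists x y, g = a * x + b * y.

(** The ideal (u, v) contains an integer prime to p: comaximality after localising the integers at
    p. *)
Definition comaximal_at (R : comNzRingType) (p : nat) (u v : R) :=
  exists a b (c : nat), coprime c p /\ a * u + b * v = c%:R.

Section Ideals.
Variable R : comNzRingType.
Implicit Types (a b g u v : R).

Lemma comaximal_at_sym p u v : comaximal_at p u v -> comaximal_at p v u.
Proof. by move=> [a [b [c [cp e]]]]; exists b, a, c; rewrite addrC. Qed.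

Lemma comaximal_at_prod (I : eqType) (s : seq I) (F : I -> R) p v :
    {in s, forall i, comaximal_at p (F i) v} ->
  comaximal_at p (\prod_(i <- s) F i) v.
Proof.
elim: s => [|i s IHs] Fv.
  by exists 1, 0, 1%N; rewrite coprime1n big_nil; split=> //; ring.
have [a [b [c [cp e]]]] := Fv i (mem_head _ _).
have [|a' [b' [c' [cp' e']]]] := IHs.
  by move=> j js; apply: Fv; rewrite inE js orbT.
exists (a * a'), (a * F i * b' + b * a' * \prod_(j <- s) F j + b * b' * v).
exists (c * c')%N; rewrite coprimeMl cp cp' big_cons natrM -e -e'.
by split=> //; ring.
Qed.

(** The integer c = a u + b v is invertible modulo p^t, so g is a multiple of a u g + b v g there.
    Inserting g in (p^t, v) into the first term and g in (p^t, u) into the second leaves multiples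
    of u v. *)
Lemma in_ideal2_mul (p t : nat) u v g : comaximal_at p u v ->
  in_ideal2 (p ^ t)%:R u g -> in_ideal2 (p ^ t)%:R v g ->
  in_ideal2 (p ^ t)%:R (u * v) g.
Proof.
move=> [a [b [c [cp e]]]] [x [y gu]] [x' [y' gv]].
(* c = 0 is prime to p only for p = 1, where p^t = 1 generates everything; the Bezout step wants c >
   0. *)
have [c0|c_gt0] := posnP c.
  have p1 : p = 1%N by move: cp; rewrite c0 /coprime gcd0n => /eqP.
  by exists g, 0; rewrite p1 exp1n; ring.
(* k inverts c modulo p^t: k c = l p^t + 1. *)
have [k l kl _] := egcdnP (p ^ t) c_gt0.
have {kl}kl : (k * c)%:R = (l * p ^ t + 1)%:R :> R.
  by rewrite kl (eqP (coprimeXr t cp)).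
exists (k%:R * (a * u * x' + b * v * x) - l%:R * g), (k%:R * (a * y' + b * y)).
transitivity (k%:R * (a * u * g + b * v * g) - l%:R * (p ^ t)%:R * g).
  transitivity ((k%:R * (a * u + b * v) - l%:R * (p ^ t)%:R) * g); last by ring.
  by rewrite e -natrM kl natrD natrM; ring.
rewrite {1}gv {1}gu; ring.
Qed.

Lemma in_ideal2_prod (I : eqType) (s : seq I) (F : I -> R) p t g :
    uniq s ->
    {in s &, forall i j, i != j -> comaximal_at p (F i) (F j)} ->
    {in s, forall i, in_ideal2 (p ^ t)%:R (F i) g} ->
  in_ideal2 (p ^ t)%:R (\prod_(i <- s) F i) g.
Proof.
elim: s => [|i s IHs] /=.
  by move=> *; exists 0, g; rewrite big_nil; ring.
move=> /andP[i_s Us] coF Fg; rewrite big_cons; apply: in_ideal2_mul.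
- apply/comaximal_at_sym/comaximal_at_prod => j js; apply: coF.
  + by rewrite inE js orbT.
  + exact: mem_head.
  + by apply: contraNneq i_s => <-.
- exact/Fg/mem_head.
- apply: IHs => // [j k js ks|j js].
  + by apply: coF; rewrite inE ?js ?ks orbT.
  + by apply: Fg; rewrite inE js orbT.
Qed.

Lemma geometric_mod_subr1 (x : R) N :
  exists y, \sum_(l < N) x ^+ l = N%:R + (x - 1) * y.
Proof.
elim: N => [|N [y e]]; first by exists 0; rewrite big_ord0; ring.
exists (y + \sum_(l < N) x ^+ l); rewrite big_ord_recr /= e -natr1 mulrDr.
have -> : x ^+ N = 1 + (x - 1) * \sum_(l < N) x ^+ l by rewrite -subrX1; ring.
by rewrite e; ring.
Qed.

(* The ideal contains W - 1 since gcd(u, v) = 1, and modulo W - 1 the geometric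
   sum is v. *)
Lemma comaximal_at_geometric (p u v : nat) (W : R) : (0 < u)%N ->
    coprime u v -> coprime v p ->
  comaximal_at p (W ^+ u - 1) (\sum_(l < v) W ^+ l).
Proof.
move=> u_gt0 uv vp; have [k l kl _] := egcdnP v u_gt0.
have [y ey] := geometric_mod_subr1 W v.
have W1 : W - 1 = ((W ^+ u) ^+ k - 1) - W * ((W ^+ v) ^+ l - 1).
  by rewrite -!exprM ![(_ * k)%N]mulnC kl (eqP uv) addn1 exprS [(l * v)%N]mulnC; ring.
exists (- y * \sum_(i < k) W ^+ u ^+ i).
exists (1 + y * W * (W - 1) * \sum_(i < l) W ^+ v ^+ i), v; split=> //.
set g := \sum_(l < v) _ in ey *.
have ev : W ^+ v - 1 = (W - 1) * g by rewrite subrX1.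
transitivity (g - y * (W - 1)); last by rewrite ey; ring.
rewrite [in RHS]W1 [_ ^+ k - 1]subrX1 [_ ^+ l - 1]subrX1 ev; ring.
Qed.
End Ideals.

(** * Cyclotomic factors of X^n - 1 and of geometric sums *)

Lemma monic_Xn_sub1 (R : nzRingType) n : (0 < n)%N -> ('X^n - 1 : {poly R}) \is monic.
Proof. by move=> n_gt0; rewrite -['X^n - 1]/('X^n - 1%:P) monicXnsubC. Qed.

(** Multiplied by X^k - 1, both sides become X^(kN) - 1, and this monic factor can be cancelled. *)
Lemma geometric_Cyclotomic k N : (0 < k * N)%N ->
  \sum_(l < N) 'X^k ^+ l = \prod_(d <- divisors (k * N) | ~~ (d %| k)%N) 'Phi_d.
Proof.
move=> kN_gt0; have k_gt0 : (0 < k)%N by move: kN_gt0; rewrite muln_gt0 => /andP[].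
apply: (mulfI (monic_neq0 (monic_Xn_sub1 _ k_gt0))).
rewrite -subrX1 -exprM -(prod_Cyclotomic kN_gt0) (bigID (fun d => d %| k)%N) /=.
congr (_ * _); rewrite -(prod_Cyclotomic k_gt0) -big_filter; apply: perm_big.
apply: uniq_perm; rewrite ?filter_uniq ?divisors_uniq // => d.
rewrite mem_filter -!dvdn_divisors //; case: (boolP (d %| k)%N) => //= dk.
by rewrite dvdn_mulr.
Qed.

Lemma Cyclotomic_dvd_geometric d k N : (0 < k * N)%N -> (d %| k * N)%N ->
  ~~ (d %| k)%N -> exists h, \sum_(l < N) 'X^k ^+ l = 'Phi_d * h.
Proof.
move=> kN_gt0 dkN dk; rewrite geometric_Cyclotomic //.
by rewrite -big_filter (bigD1_seq d) /= ?filter_uniq ?divisors_uniq ?mem_filter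
     -?dvdn_divisors ?dk //; eexists.
Qed.

Lemma Cyclotomic_dvd_Xn_sub1 d n : (0 < n)%N -> (d %| n)%N ->
  exists h, 'X^n - 1 = 'Phi_d * h.
Proof.
move=> n_gt0 dn; rewrite -(prod_Cyclotomic n_gt0).
by rewrite (bigD1_seq d) /= ?divisors_uniq -?dvdn_divisors //; eexists.
Qed.

(** As d and d' differ, one of them does not divide the other; by symmetry let it be d'. With g =
    gcd(d, d'), d = u g, d' = v g and W = X^(g p^s), the two cyclotomic polynomials divide W^u - 1
    and 1 + W + ... + W^(v-1), which are comaximal away from p. *)
Lemma comaximal_at_Cyclotomic p s d d' : (0 < p)%N -> (0 < d)%N -> (0 < d')%N ->
  coprime d p -> coprime d' p -> d != d' ->
  comaximal_at p 'Phi_(d * p ^ s) 'Phi_(d' * p ^ s).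
Proof.
move=> p_gt0; wlog ndvd : d d' / ~~ (d' %| d)%N => [IH d0 d'0 dp d'p dd'|].
  have [d'd|] := boolP (d' %| d)%N; last by move=> ?; apply: IH.
  apply/comaximal_at_sym/IH; rewrite 1?eq_sym //.
  by apply: contraNN dd' => dd'; rewrite eqn_dvd dd'.
move=> d0 d'0 dp d'p _; set g := gcdn d d'.
have g_gt0 : (0 < g)%N by rewrite gcdn_gt0 d0.
have /dvdnP[u du] : (g %| d)%N by rewrite dvdn_gcdl.
have /dvdnP[v dv] : (g %| d')%N by rewrite dvdn_gcdr.
have uv : coprime u v.
  by rewrite /coprime -(eqn_pmul2r g_gt0) muln_gcdl -du -dv mul1n.
have u_gt0 : (0 < u)%N by move: d0; rewrite du muln_gt0 => /andP[].
have vp : coprime v p by move: d'p; rewrite dv coprimeMl => /andP[].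
have [a [b [c [cp e]]]] :=
  comaximal_at_geometric ('X^(g * p ^ s) : {poly int}) u_gt0 uv vp.
have eN k : (g * p ^ s * k)%N = (k * g * p ^ s)%N by lia.
have [||h1 e1] := @Cyclotomic_dvd_Xn_sub1 (d * p ^ s) (d * p ^ s).
- by rewrite muln_gt0 d0 expn_gt0 p_gt0.
- exact: dvdnn.
have [|||h2 e2] := @Cyclotomic_dvd_geometric (d' * p ^ s) (g * p ^ s) v.
- by rewrite eN -dv muln_gt0 d'0 expn_gt0 p_gt0.
- by rewrite eN -dv.
- rewrite dvdn_pmul2r ?expn_gt0 ?p_gt0 //.
  by apply: contraNN ndvd => /dvdn_trans; apply; apply: dvdn_gcdl.
exists (a * h1), (b * h2), c; split=> //; rewrite -e e2 -exprM eN -du e1; ring.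
Qed.

(** * The polynomials G_s and successive division by them *)

Section Tower.
Variables m p : nat.
Hypotheses (p_pr : prime p) (m_gt0 : (0 < m)%N).

(** G_s, with the quotient for s > 0 written out as a geometric sum. *)
Definition tower (s : nat) : {poly int} :=
  if s is s'.+1 then \sum_(l < p) 'X^(m * p ^ s') ^+ l else 'X^m - 1.

Let p_gt0 : (0 < p)%N := prime_gt0 p_pr.

Let mps_gt0 s : (0 < m * p ^ s)%N.
Proof. by rewrite muln_gt0 m_gt0 expn_gt0 p_gt0. Qed.

Lemma towerS_mul s :
  tower s.+1 * ('X^(m * p ^ s) - 1) = 'X^(m * p ^ s.+1) - 1.
Proof. by rewrite mulrC -subrX1 -exprM -mulnA expnSr. Qed.

Lemma tower_monic s : tower s \is monic.
Proof.
case: s => [|s]; first exact: monic_Xn_sub1.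
by rewrite -(monicMr _ (monic_Xn_sub1 _ (mps_gt0 s))) towerS_mul monic_Xn_sub1.
Qed.

Lemma tower_dvd_Xn_sub1 i s : (i <= s)%N ->
  exists h, 'X^(m * p ^ s) - 1 = tower i * h.
Proof.
move=> /subnK <-; elim: (s - i)%N => [|r [h IH]].
  rewrite add0n; case: i => [|i]; first by exists 1; rewrite mulr1 muln1.
  by exists ('X^(m * p ^ i) - 1); rewrite towerS_mul.
by exists (tower (r + i).+1 * h); rewrite addSn -towerS_mul IH; ring.
Qed.

(** G_i divides X^(m p^(s-1)) - 1, so each of the p terms of G_s is 1 modulo G_i. *)
Lemma tower_mod i s : (i < s)%N -> exists y, tower s = p%:R + tower i * y.
Proof.
case: s => // s is_; have [h e] := tower_dvd_Xn_sub1 (is_ : (i <= s)%N).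
have [y ey] := geometric_mod_subr1 ('X^(m * p ^ s) : {poly int}) p.
by exists (h * y); rewrite [LHS]ey e mulrA.
Qed.

(** The product G_s G_(s-1) ... of t factors, meant for t <= s+1: after G_0 the index [s.-1]
    stalls. *)
Fixpoint tower_top (s t : nat) : {poly int} :=
  if t is t'.+1 then tower s * tower_top s.-1 t' else 1.

Lemma tower_top_mul s t : (t <= s)%N ->
  tower_top s t * ('X^(m * p ^ (s - t)) - 1) = 'X^(m * p ^ s) - 1.
Proof.
elim: t s => [|t IHt] [|s] //= ts; rewrite ?mul1r ?subn0 //.
by rewrite subSS -mulrA IHt // towerS_mul.
Qed.

Lemma tower_top_full s : tower_top s s.+1 = 'X^(m * p ^ s) - 1.
Proof.
elim: s => [|s IHs]; first by rewrite /= mulr1 muln1.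
by rewrite -[LHS]/(tower s.+1 * tower_top s s.+1) IHs towerS_mul.
Qed.

Lemma tower_top_monic s t : tower_top s t \is monic.
Proof.
elim: t s => [|t IHt] s; first exact: monic1.
by rewrite /= monicMl ?tower_monic.
Qed.

Lemma size_tower_top s t : (t <= s)%N ->
  size (tower_top s t) = (m * p ^ s - m * p ^ (s - t)).+1.
Proof.
move=> ts; have := congr1 (size : {poly int} -> nat) (tower_top_mul ts).
rewrite size_monicM ?tower_top_monic ?monic_neq0 ?monic_Xn_sub1 //.
rewrite -[1]/(1%:P) !size_XnsubC // addnS /= => /eqP.
have := polySpred (monic_neq0 (tower_top_monic s t)).
by move=> -> /eqP ?; congr _.+1; lia.
Qed.

(* Dividing g = p^(t+1) x + G_s k through: G_s = p modulo every lower G_i, and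
   G_i is monic, so k lies in (p^t, G_i) for every i < s. *)
Lemma in_ideal2_tower_top s t g : (t <= s.+1)%N ->
    (forall i, (i <= s)%N -> in_ideal2 (p ^ t)%:R (tower i) g) ->
  in_ideal2 p%:R (tower_top s t) g.
Proof.
elim: t s g => [|t IHt] s g ts Tg; first by exists 0, g => /=; ring.
have [x [k ek]] := Tg s (leqnn s).
(* With g = p^(t+1) x + G_s k, it remains to place k in the ideal of p and the next t factors. *)
suff [x' [y' ek']] : in_ideal2 p%:R (tower_top s.-1 t) k.
  exists ((p ^ t)%:R * x + tower s * x'), y'.
  by rewrite ek ek' /= expnS natrM; ring.
case: s => [|s] in ts Tg ek *.
  have -> : t = 0%N by lia.
  by exists 0, k => /=; ring.
rewrite succnK; apply: IHt => // i is_.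
have [y ey] := tower_mod (is_ : (i < s.+1)%N).
have [|x' [y' eg]] := Tg i; first exact: leqW.
(* Compare the expressions of g in (p^(t+1), G_s) and (p^(t+1), G_i), using G_s = p + G_i y. *)
have pk : p%:R * k = (p ^ t.+1)%:R * (x' - x) + tower i * (y' - y * k).
  transitivity ((g - (p ^ t.+1)%:R * x) - tower i * y * k).
    by rewrite ek ey; ring.
  by rewrite eg; ring.
move: pk; set z := y' - _ => pk.
(* The relation must be divided by p, so p has to divide z. Since p w = G_i z and G_i is monic, p
   kills the remainder of w by G_i; hence that remainder is 0 and z is p times the quotient. *)
pose w := k - (p ^ t)%:R * (x' - x).
have pw : p%:R * w = tower i * z.
  by rewrite /w mulrBr pk expnS natrM; ring.
have zE : z = p%:R * (w %/ tower i).
  apply: (mulfI (monic_neq0 (tower_monic i))); rewrite -pw.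
  have wE := Pdiv.IdomainMonic.divp_eq (tower_monic i) w.
  have w0 : w %% tower i = 0.
    have p0 : (p%:R : int) != 0 by rewrite pnatr_eq0 -lt0n.
    have : p%:R *: (w %% tower i) == 0.
      rewrite -Pdiv.IdomainUnit.modpZl ?(monicP (tower_monic i)) ?unitr1 //.
      by rewrite scaler_nat -mulr_natl pw mulrC modp_mull.
    by rewrite -mul_polyC mulf_eq0 polyC_eq0 (negPf p0) => /eqP.
  by rewrite {1}wE w0; ring.
exists (x' - x), (w %/ tower i).
apply: (@mulfI _ p%:R); first by rewrite -polyC_natr polyC_eq0 pnatr_eq0 -lt0n.
by rewrite pk zE expnS natrM; ring.
Qed.

Hypothesis mp : coprime m p.

(** For s > 0, the divisors of m p^s that do not divide m p^(s-1) are the d p^s with d dividing m,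
    because m is prime to p. *)
Lemma towerE s : tower s = \prod_(d <- divisors m) 'Phi_(d * p ^ s).
Proof.
case: s => [|s].
  rewrite /= -prod_Cyclotomic //.
  by apply: eq_bigr => d _; rewrite muln1.
have E : (m * p ^ s * p = m * p ^ s.+1)%N by rewrite expnSr mulnA.
rewrite /= geometric_Cyclotomic E //.
rewrite -[RHS](big_map (fun d => d * p ^ s.+1)%N predT (fun d => 'Phi_d)).
rewrite -big_filter; apply: perm_big.
have inj : injective (fun d => d * p ^ s.+1)%N.
  by move=> x y /eqP; rewrite eqn_pmul2r ?expn_gt0 ?p_gt0 // => /eqP.
apply: uniq_perm; rewrite ?filter_uniq ?map_inj_uniq ?divisors_uniq // => d.
rewrite mem_filter -dvdn_divisors //; apply/andP/mapP => [[dN dD]|[c]].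
  (* Otherwise the p-part of d divides p^s and its prime-to-p part divides m, so d would divide m
     p^s. *)
  have pd : (p ^ s.+1 %| d)%N.
    have d_gt0 : (0 < d)%N := dvdn_gt0 (mps_gt0 _) dD.
    rewrite pfactor_dvdn //; apply: contraNltn dN => ds.
    have [c' pc' dE'] := pfactor_coprime p_pr d_gt0.
    rewrite dE' dvdn_mul ?dvdn_exp2l //.
    have := dD; rewrite dE' => /(dvdn_trans (dvdn_mulr _ (dvdnn c'))).
    by rewrite Gauss_dvdl // coprime_sym coprimeXl.
  have /dvdnP[c dE] := pd; exists c => //; rewrite -dvdn_divisors //.
  by move: dD; rewrite dE dvdn_pmul2r ?expn_gt0 ?p_gt0.
rewrite -dvdn_divisors // => cm ->; split; last exact: dvdn_mul.
apply/negP=> /(dvdn_trans (dvdn_mull _ (dvdnn _))).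
rewrite Gauss_dvdr ?coprimeXl 1?coprime_sym //.
by rewrite dvdn_Pexp2l ?prime_gt1 // ltnn.
Qed.

Lemma in_ideal2_tower s t g :
    (forall d, (d %| m * p ^ s)%N -> in_ideal2 (p ^ t)%:R 'Phi_d g) ->
  in_ideal2 (p ^ t)%:R (tower s) g.
Proof.
move=> Pg; rewrite towerE; apply: in_ideal2_prod; first exact: divisors_uniq.
  move=> d d'; rewrite -!dvdn_divisors // => dm d'm.
  by apply: comaximal_at_Cyclotomic => //;
    [exact: dvdn_gt0 dm | exact: dvdn_gt0 d'm
    |exact: coprime_dvdl dm mp | exact: coprime_dvdl d'm mp].
by move=> d; rewrite -dvdn_divisors // => dm; apply: Pg; rewrite dvdn_mul.
Qed.
End Tower.

(** * Lattices and Smith forms modulo p *)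

(** Column j read in the basis of powers of X, so that column j of [Amat n *m W] lists the
    coordinates of its image under Psi_n. *)
Definition colpoly (R : nzSemiRingType) (n k : nat) (W : 'M[R]_(n, k)) (j : 'I_k)
  : {poly R} := rVpoly (col j W)^T.

Lemma colpolyE (R : nzSemiRingType) n k (W : 'M[R]_(n, k)) j :
  colpoly W j = \sum_(l < n) W l j *: 'X^l.
Proof.
rewrite /colpoly [X in rVpoly X]row_sum_delta linear_sum.
by apply: eq_bigr => l _; rewrite linearZ /= rVpoly_delta !mxE.
Qed.

Lemma mem_row_labels n d i : (0 < n)%N ->
  ((d, i) \in row_labels n) = (d %| n)%N && (i < totient d)%N.
Proof.
move=> n_gt0; apply/flatten_mapP/andP => [[d' ]|[dn id_]].
  by rewrite -dvdn_divisors // => dn /mapP[i' + [-> ->]]; rewrite mem_iota.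
by exists d; rewrite -?dvdn_divisors // map_f // mem_iota.
Qed.

Lemma size_row_labels n : (0 < n)%N -> size (row_labels n) = n.
Proof.
move=> n_gt0; rewrite size_flatten sumnE !big_map.
under eq_bigr do rewrite size_map size_iota.
rewrite -[RHS]sum_totient_dvd -(big_mkord (fun d => d %| n)%N) -[RHS]big_filter.
apply: perm_big; apply: uniq_perm; rewrite ?filter_uniq ?divisors_uniq ?iota_uniq //.
move=> d; rewrite mem_filter mem_index_iota -dvdn_divisors //=.
by case: (boolP (d %| n)%N) => //= /dvdn_leq; rewrite ltnS => ->.
Qed.

Lemma row_copid_mul (R : pzRingType) i n k (B : 'M[R]_(n, k)) l :
  row l (copid_mx i *m B) = if (l < i)%N then 0 else row l B.
Proof.
apply/rowP => j; rewrite mulmxBl mul1mx !mxE (bigD1 l) //= !mxE eqxx /=.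
rewrite big1 ?addr0 => [|h /negPf hl]; last first.
  by rewrite mxE val_eqE eq_sym hl mul0r.
by case: ifP => _; rewrite ?mul1r ?subrr ?mul0r ?subr0 !mxE.
Qed.

(** Reduction modulo Phi_d is linear, its leading coefficient being a unit. *)
Lemma Amat_mulE n k (W : 'M[int]_(n, k)) r j :
  (Amat n *m W) r j =
  let: (d, i) := nth (0%N, 0%N) (row_labels n) r in
  (colpoly W j %% 'Phi_d)`_i.
Proof.
rewrite mxE; case E: (nth _ _ _) => [d i].
have Pu : lead_coef 'Phi_d \is a GRing.unit.
  by rewrite (monicP (Cyclotomic_monic d)) unitr1.
rewrite colpolyE (big_morph _ (Pdiv.IdomainUnit.modpD Pu) (mod0p _)) coef_sum.
apply: eq_bigr => l _; rewrite (Pdiv.IdomainUnit.modpZl Pu) coefZ mxE E.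
by rewrite mulrC.
Qed.

Lemma dvdz_polyP (q : nat) (f : {poly int}) :
  (forall i, (q %| f`_i)%Z) -> exists x, f = q%:R * x.
Proof.
move=> qf; exists (\poly_(i < size f) (f`_i %/ q)%Z); apply/polyP => i.
rewrite mulr_natl coefMn coef_poly; case: ltnP => [_|fi].
  by rewrite -mulr_natr natz divzK.
by rewrite mul0rn nth_default.
Qed.

Lemma Amat_dvdzP (q n k : nat) (W : 'M[int]_(n, k)) j : (0 < n)%N ->
  (forall r, (q %| (Amat n *m W) r j)%Z) <->
  (forall d, (d %| n)%N -> in_ideal2 q%:R 'Phi_d (colpoly W j)).
Proof.
move=> n_gt0; split=> [qW d dn | Wd r].
  have Pm := Cyclotomic_monic d.
  rewrite (Pdiv.IdomainMonic.divp_eq Pm (colpoly W j)).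
  have [i|x ->] := @dvdz_polyP q (colpoly W j %% 'Phi_d); last first.
    by exists x, (colpoly W j %/ 'Phi_d); ring.
  (* Coefficients from phi(d) on vanish by degree; the others are entries of some row. *)
  have [id_|id_] := ltnP i (totient d); last first.
    rewrite nth_default ?dvdz0 // (leq_trans _ id_) // -ltnS.
    by rewrite -size_Cyclotomic ltn_modp monic_neq0.
  have di : (d, i) \in row_labels n by rewrite mem_row_labels ?dn.
  have rn : (index (d, i) (row_labels n) < n)%N.
    by rewrite -[ltnRHS](size_row_labels n_gt0) index_mem.
  by have := qW (Ordinal rn); rewrite Amat_mulE nth_index.
rewrite Amat_mulE; case E: (nth _ _ _) => [d i].
have : (d, i) \in row_labels n by rewrite -E mem_nth // size_row_labels.
rewrite mem_row_labels // => /andP[dn _]; have [x [y ->]] := Wd d dn.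
have Pu : lead_coef 'Phi_d \is a GRing.unit.
  by rewrite (monicP (Cyclotomic_monic d)) unitr1.
rewrite (Pdiv.IdomainUnit.modpD Pu) modp_mulr addr0 mulr_natl -scaler_nat.
by rewrite (Pdiv.IdomainUnit.modpZl Pu) coefZ dvdz_mulr // natz.
Qed.

Section SmithForm.
Variables (p t n : nat) (e : seq nat) (M L R : 'M[int]_n).
Hypotheses (p_pr : prime p) (e_size : size e = n) (e_sorted : sorted dvdn e).
Hypotheses (L_unit : L \in unitmx) (R_unit : R \in unitmx).
Hypothesis MLR :
  M = L *m (\matrix_(i, j) ((nth 0%N e i)%:Z *+ (i == j :> nat))) *m R.

Let D : 'M[int]_n := \matrix_(i, j) ((nth 0%N e i)%:Z *+ (i == j :> nat)).

Let red : {rmorphism int -> 'F_p} := intr.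

Let red_eq0 x : (red x == 0) = (p %| x)%Z.
Proof. by rewrite /red -(dvdz_pcharf (pchar_Fp p_pr)). Qed.

Let dvdn_nth i j : (i <= j < n)%N -> (nth 0%N e i %| nth 0%N e j)%N.
Proof.
move=> /andP[ij jn]; apply: (sorted_leq_nth dvdn_trans dvdnn) => //.
- by rewrite inE e_size (leq_ltn_trans ij).
- by rewrite inE e_size.
Qed.

Let mulD k (B : 'M[int]_(n, k)) i j : (D *m B) i j = (nth 0%N e i)%:Z * B i j.
Proof.
rewrite mxE (bigD1 i) //= mxE eqxx mulr1n big1 ?addr0 // => l li.
by rewrite mxE val_eqE eq_sym (negPf li) mulr0n mul0r.
Qed.

Let mulmx_dvdz k (A : 'M[int]_n) (B : 'M[int]_(n, k)) (q : nat) j :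
  (forall i, (q %| B i j)%Z) -> forall i, (q %| (A *m B) i j)%Z.
Proof.
move=> qB i; rewrite mxE rpred_sum // => l _.
exact: dvdz_mull.
Qed.

(** The left inverse W makes the k columns of U independent modulo p. If p^t did not divide e_i, it
    would divide no earlier e_l, so rows 0 to i of R U would vanish modulo p and leave rank at most
    n - i - 1 < k. *)
Lemma smith_dvdn_ge k (W : 'M[int]_(k, n)) (U : 'M[int]_(n, k)) i :
    W *m U = 1%:M -> (forall r j, ((p ^ t)%N %| (M *m U) r j)%Z) ->
    (n - k <= i < n)%N -> (p ^ t %| nth 0%N e i)%N.
Proof.
move=> WU pMU /andP[ki in_]; apply: contraT => pe.
pose B := R *m U.
have pB (l : 'I_n) j : (l <= i)%N -> (p %| B l j)%Z.
  move=> li; have : ((p ^ t)%N %| (D *m B) l j)%Z.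
    suff -> : D *m B = invmx L *m (M *m U) by apply: mulmx_dvdz.
    by rewrite MLR !mulmxA mulVmx // mul1mx.
  rewrite mulD !dvdzE abszM absz_nat => pDB; apply: contraNT pe => pB.
  move: pDB; rewrite Gauss_dvdl ?coprimeXl ?prime_coprime //.
  by move=> /dvdn_trans; apply; apply: dvdn_nth; rewrite li.
have BE : map_mx red B = copid_mx i.+1 *m map_mx red B.
  apply/row_matrixP => l; rewrite row_copid_mul ltnS; case: leqP => // li.
  by apply/rowP => j; rewrite [RHS]mxE 2!mxE; apply/eqP; rewrite red_eq0 pB.
have k_le : (k <= \rank (map_mx red B))%N.
  apply: (@mulmx1_min_rank _ _ _ _ _ (map_mx red (W *m invmx R)) 1%:M).
  by rewrite mulmx1 -map_mxM mulmxA mulmxKV // WU map_mx1.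
have : (k <= n - i.+1)%N.
  by rewrite (leq_trans k_le) // BE -(@rank_copid_mx 'F_p n i.+1) // mxrankM_maxl.
by have := mulmx1_min WU; lia.
Qed.

(** The columns j >= i of the inverse of R are independent modulo p, and M sends them to multiples
    of p^t. Modulo p they are thus multiples of H of degree below n, a space of dimension k, whence
    n - i <= k. *)
Lemma smith_dvdn_le k (H : {poly int}) i :
    H \is monic -> size H = (n - k).+1 -> (k <= n)%N ->
    (forall (V : 'M[int]_n) j, (forall r, ((p ^ t)%N %| (M *m V) r j)%Z) ->
       in_ideal2 p%:R H (colpoly V j)) ->
    (i < n)%N -> (p ^ t %| nth 0%N e i)%N -> (n - k <= i)%N.
Proof.
move=> H_monic H_size kn MV in_ pe.
pose V := invmx R; pose P := map_mx red V^T; pose h := map_poly red H.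
have h_monic : h \is monic by apply: monic_map.
have h_size : size h = (n - k).+1.
  by rewrite size_map_poly_id0 // (monicP H_monic) rmorph1 oner_eq0.
have P_unit : P \in unitmx.
  by rewrite unitmxE det_map_mx rmorph_unit // -unitmxE unitmx_tr unitmx_inv.
(* The rows h X^r, r < k, span the multiples of h of degree below n. *)
pose T : 'M['F_p]_(k, n) := \matrix_(r < k) poly_rV (h * 'X^r).
have PT (j : 'I_n) : (i <= j)%N -> (row j P <= T)%MS.
  move=> ij; have [r|x [y xy]] := MV V j.
    rewrite MLR mulmxK //; apply: mulmx_dvdz => l; rewrite mxE dvdzE.
    case: eqP => [->|_]; rewrite ?mulr0n ?dvdn0 // mulr1n.
    by apply: dvdn_trans pe _; apply: dvdn_nth; rewrite ij /=.
  have {xy} : rVpoly (row j P) = h * map_poly red y.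
    have -> : row j P = map_mx red (col j V)^T by rewrite /P -map_row tr_col.
    rewrite -map_rVpoly -/(colpoly V j) xy rmorphD !rmorphM /= rmorph_nat.
    by rewrite -polyC_natr (pcharf0 (pchar_Fp p_pr)) polyC0 mul0r add0r.
  set z := map_poly red y => vz.
  have z_size : (size z <= k)%N.
    have [->|z0] := eqVneq z 0; first by rewrite size_poly0.
    have : (size (h * z)%R <= n)%N by rewrite -vz size_poly.
    by rewrite size_monicM // h_size; lia.
  rewrite -[row j P]rVpolyK vz -[z](poly_rV_K z_size) /rVpoly poly_def mulr_sumr.
  rewrite linear_sum; apply: summx_sub => r _; rewrite -scalerAr linearZ.
  by apply: scalemx_sub; have := row_sub r T; rewrite rowK.
have /mxrankS : (copid_mx i *m P <= T)%MS.
  apply/row_subP => j; rewrite row_copid_mul.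
  by case: ltnP => [_|/PT //]; rewrite sub0mx.
rewrite mxrankMfree ?row_free_unit // rank_copid_mx ?(ltnW in_) // => ni.
by have := leq_trans ni (rank_leq_row T); lia.
Qed.
End SmithForm.

(** * Prime powers dividing the elementary divisors of A_n *)

Lemma size_geometric_Xn (R : idomainType) k N : (0 < k)%N -> (0 < N)%N ->
  size (\sum_(l < N) 'X^k ^+ l : {poly R}) = (k * N - k).+1.
Proof.
move=> k_gt0 N_gt0; have kN_gt0 : (0 < k * N)%N by rewrite muln_gt0 k_gt0.
have Xk0 := monic_neq0 (monic_Xn_sub1 R k_gt0).
have e := subrX1 ('X^k : {poly R}) N; rewrite -exprM in e.
have g0 : \sum_(l < N) 'X^k ^+ l != 0 :> {poly R}.
  apply: contraTneq (monic_neq0 (monic_Xn_sub1 R kN_gt0)) => g0.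
  by rewrite e g0 mulr0 eqxx.
have := congr1 (size : {poly R} -> nat) e; rewrite size_mul //.
rewrite -[1]/(1%:P) !size_XnsubC //; have := polySpred g0.
by move: (size _) => [|s] //= _; lia.
Qed.

Section AmatDivisors.
Variables (n : nat) (e : seq nat).
Hypotheses (n_gt0 : (0 < n)%N) (eP : elementary_divisors (Amat n) e).

Lemma Amat_divisor_dvdn_ge p t i : prime p -> (t <= logn p n)%N ->
  (n - n %/ p ^ t <= i < n)%N -> (p ^ t %| nth 0%N e i)%N.
Proof.
move=> p_pr tn; case: eP => e_size e_sorted [L L_unit [R R_unit MLR]].
set k := (n %/ p ^ t)%N; have nE : (k * p ^ t = n)%N by rewrite divnK ?pfactor_dvdn.
have /andP[k_gt0 pt_gt0] : (0 < k)%N && (0 < p ^ t)%N by rewrite -muln_gt0 nE.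
pose F : {poly int} := \sum_(l < p ^ t) 'X^k ^+ l.
have F_size : size F = (n - k).+1 by rewrite size_geometric_Xn // nE.
pose U : 'M[int]_(n, k) := \matrix_(j < n, i < k) (F * 'X^i)`_j.
(* W extracts the first k coefficients. As F = 1 modulo X^k, those of F, F X, ..., F X^(k-1) form
   the identity matrix. *)
pose W : 'M[int]_(k, n) := \matrix_(i < k, j < n) (i == j :> nat)%:R.
have kn : (k <= n)%N by rewrite leq_div.
apply: (@smith_dvdn_ge p t n e _ _ _ p_pr e_size e_sorted L_unit R_unit MLR k W U).
  apply/matrixP => a b; rewrite !mxE (bigD1 (widen_ord kn a)) //= !mxE eqxx mul1r.
  rewrite big1 ?addr0 => [|l la]; last first.
    rewrite !mxE; case: eqP => [al|_]; last by rewrite mul0r.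
    by case/eqP: la; apply/val_inj.
  have -> : F = 1 + 'X^k * \sum_(l < (p ^ t).-1) 'X^k ^+ l.
    rewrite /F; case: (p ^ t)%N pt_gt0 => // N _; rewrite big_ord_recl expr0 mulr_sumr.
    by congr (_ + _); apply: eq_bigr => l _; rewrite -exprS.
  rewrite mulrDl mul1r -mulrA coefD coefXn coefXnM /= ltn_ord addr0.
  by rewrite val_eqE.
move=> r j; move: r; apply/Amat_dvdzP => // d dn.
have -> : colpoly U j = F * 'X^j.
  apply/polyP => l; have [ln|nl] := ltnP l n.
    by rewrite -[l]/(val (Ordinal ln)) coef_rVpoly_ord !mxE.
  rewrite !nth_default // ?(leq_trans (size_poly _ _)) //.
  rewrite (leq_trans (size_polyMleq _ _)) // size_polyXn F_size.
  by have := ltn_ord j; lia.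
(* Phi_d divides F unless d divides k; in that case X^k = 1 modulo Phi_d and F becomes p^t. *)
have [dk|dk] := boolP (d %| k)%N; last first.
  have [||h Fh] := @Cyclotomic_dvd_geometric d k (p ^ t) _ _ dk; rewrite ?nE //.
  rewrite /F Fh.
  by exists 0, (h * 'X^j); ring.
have [y Fy] := geometric_mod_subr1 ('X^k : {poly int}) (p ^ t).
have [h Xh] := Cyclotomic_dvd_Xn_sub1 k_gt0 dk; rewrite /F Fy Xh.
by exists 'X^j, (h * y * 'X^j); ring.
Qed.

Let in_ideal2_Amat p t (V : 'M[int]_n) j : prime p -> (t <= (logn p n).+1)%N ->
  (forall r, ((p ^ t)%N %| (Amat n *m V) r j)%Z) ->
  in_ideal2 p%:R (tower_top (n %/ p ^ logn p n) p (logn p n) t) (colpoly V j).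
Proof.
move=> p_pr tn /(Amat_dvdzP _ _ _ n_gt0) Vd.
have pn : (p ^ logn p n %| n)%N by rewrite pfactor_dvdnn.
have m_gt0 : (0 < n %/ p ^ logn p n)%N.
  by rewrite divn_gt0 ?expn_gt0 ?prime_gt0 // dvdn_leq.
have mp : coprime (n %/ p ^ logn p n) p.
  have [c pc nE] := pfactor_coprime p_pr n_gt0.
  by rewrite {1}nE mulnK ?expn_gt0 ?prime_gt0 // coprime_sym.
apply: in_ideal2_tower_top => // i iN; apply: in_ideal2_tower => // d dm.
apply: Vd; apply: dvdn_trans dm _.
by rewrite -[X in (_ %| X)%N](divnK pn) dvdn_mul ?dvdn_exp2l.
Qed.

Lemma Amat_divisor_dvdn p t i : prime p -> (t <= logn p n)%N -> (i < n)%N ->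
  (p ^ t %| nth 0%N e i)%N = (n - n %/ p ^ t <= i)%N.
Proof.
move=> p_pr tn in_; apply/idP/idP => [pe|ni]; last first.
  by apply: Amat_divisor_dvdn_ge; rewrite ?ni.
case: eP => e_size e_sorted [L L_unit [R R_unit MLR]].
have p_gt0 := prime_gt0 p_pr.
have pn : (p ^ logn p n %| n)%N by rewrite pfactor_dvdnn.
have m_gt0 : (0 < n %/ p ^ logn p n)%N.
  by rewrite divn_gt0 ?expn_gt0 ?p_gt0 // dvdn_leq.
have nE : (n %/ p ^ logn p n * p ^ (logn p n - t) = n %/ p ^ t)%N.
  apply/eqP; rewrite -(eqn_pmul2r (_ : 0 < p ^ t)%N) ?expn_gt0 ?p_gt0 //.
  by rewrite -mulnA -expnD subnK // !divnK // pfactor_dvdn.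
apply: (@smith_dvdn_le p t n e _ _ _ p_pr e_size e_sorted L_unit R_unit MLR
  (n %/ p ^ t) (tower_top (n %/ p ^ logn p n) p (logn p n) t)) => //.
- exact: tower_top_monic.
- by rewrite (size_tower_top p_pr m_gt0 tn) divnK // nE.
- exact: leq_div.
- by move=> V j; apply: in_ideal2_Amat => //; apply: leqW.
Qed.

Lemma Amat_divisor_ndvdn p i : prime p -> (i < n)%N ->
  ~~ (p ^ (logn p n).+1 %| nth 0%N e i)%N.
Proof.
move=> p_pr in_; apply/negP => pe.
case: eP => e_size e_sorted [L L_unit [R R_unit MLR]].
have pn : (p ^ logn p n %| n)%N by rewrite pfactor_dvdnn.
(* For t = a+1 the product of all the G_i is X^n - 1, of degree n, so the dimension bound is k =
   0. *)
suff : (n - 0 <= i)%N by rewrite subn0 leqNgt in_.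
apply: (@smith_dvdn_le p _ n e _ _ _ p_pr e_size e_sorted L_unit R_unit MLR
  0 ('X^n - 1) i _ _ _ _ in_ pe) => //; first exact: monic_Xn_sub1.
  by rewrite -[1]/(1%:P) size_XnsubC ?subn0.
move=> V j /(in_ideal2_Amat p_pr (leqnn _)).
by rewrite tower_top_full divnK.
Qed.
End AmatDivisors.

Local Close Scope ring_scope.

(** * Ratios of consecutive elementary divisors *)

(* The numbers v_p(e_j) jump exactly at the indices n - n/p^t + 1, and these are
   pairwise distinct as p^t runs over the prime powers dividing n. *)
Section Ratios.
Variables (n : nat) (e : seq nat).
Hypotheses (n_gt0 : 0 < n) (e_size : size e = n) (e_sorted : sorted dvdn e).
Hypothesis eP : forall p t i, prime p -> t <= logn p n -> i < n ->
  (p ^ t %| nth 0 e i) = (n - n %/ p ^ t <= i).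
Hypothesis eN : forall p i, prime p -> i < n -> ~~ (p ^ (logn p n).+1 %| nth 0 e i).

(** One-based with E 0 = 1, matching e_0 = 1, while [nth 0 e] counts from zero. *)
Let E j := nth 1 (1 :: e) j.
Let pos p t := n - n %/ p ^ t + 1.

Let ES j : j < n -> E j.+1 = nth 0 e j.
Proof. by move=> jn; rewrite /E /=; apply: set_nth_default; rewrite e_size. Qed.

(** A zero divisor would be divisible by every power of 2, against [eN]. *)
Let E_gt0 j : j <= n -> 0 < E j.
Proof.
case: j => // j jn; rewrite ES // lt0n; apply: contraTneq (eN (isT : prime 2) jn).
by move=> ->; rewrite dvdn0.
Qed.

Let E_dvdn j : 0 < j <= n -> E j.-1 %| E j.
Proof.
case: j => // -[|j] /= jn; first exact: dvd1n.
rewrite !ES ?(ltnW jn) //; apply: (sorted_leq_nth dvdn_trans dvdnn) => //;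
  by rewrite inE e_size // ltnW.
Qed.

Let logn_E_le p j : prime p -> j <= n -> logn p (E j) <= logn p n.
Proof.
case: j => [|j] p_pr jn; first by rewrite logn1.
by rewrite leqNgt -pfactor_dvdn ?E_gt0 // ES // eN.
Qed.

Let leq_logn_E p t j : prime p -> 0 < t <= logn p n -> j <= n ->
  (t <= logn p (E j)) = (pos p t <= j).
Proof.
move=> p_pr /andP[t_gt0 tn] jn; rewrite /pos addn1.
case: j jn => [|j] jn; first by rewrite logn1 ltn0 leqNgt t_gt0.
by rewrite -pfactor_dvdn ?E_gt0 // ES // eP.
Qed.

(** The position determines the quotient n/p^s, hence p^s. *)
Let pos_eq p q s t : prime p -> prime q -> s <= logn p n -> t <= logn q n ->
  pos p s = pos q t -> p ^ s = q ^ t.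
Proof.
move=> p_pr q_pr sn tn /eqP; rewrite eqn_add2r => /eqP eq_pos.
have eq_div : n %/ p ^ s = n %/ q ^ t.
  by have := leq_div n (p ^ s); have := leq_div n (q ^ t); lia.
have ps : p ^ s %| n by rewrite pfactor_dvdn.
have qt : q ^ t %| n by rewrite pfactor_dvdn.
have k_gt0 : 0 < n %/ q ^ t.
  by rewrite divn_gt0 ?expn_gt0 ?prime_gt0 // dvdn_leq.
apply/eqP; rewrite -(eqn_pmul2l k_gt0) -{1}eq_div !divnK //.
Qed.

Let pos_inj p q s t : prime p -> prime q ->
  0 < s <= logn p n -> t <= logn q n -> pos p s = pos q t -> p = q /\ s = t.
Proof.
move=> p_pr q_pr /andP[s_gt0 sn] tn /(pos_eq p_pr q_pr sn tn) pq.
have {}pq' : p = q.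
  have : p %| q ^ t by rewrite -pq dvdn_exp.
  rewrite Euclid_dvdX // => /andP[+ _].
  by rewrite dvdn_prime2 // => /eqP.
split=> //; move: pq; rewrite pq' => /eqP; rewrite eqn_exp2l ?prime_gt1 //.
by move/eqP.
Qed.

Let pos_lt p s : prime p -> s < logn p n -> pos p s < pos p s.+1.
Proof.
move=> p_pr sn; rewrite ltn_neqAle; apply/andP; split.
  apply/eqP => /(pos_eq p_pr p_pr (ltnW sn) sn)/eqP.
  by rewrite eqn_exp2l ?prime_gt1 // ltn_eqF.
by rewrite leq_add2r leq_sub2l // leq_div2l ?expn_gt0 ?prime_gt0 // leq_exp2l ?prime_gt1.
Qed.

Lemma logn_ed_ratio p j : 0 < j <= n ->
  logn p (ed_ratio e j) = logn p (E j) - logn p (E j.-1).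
Proof. by move=> jn; rewrite /ed_ratio logn_div ?E_dvdn. Qed.

Lemma ed_ratio_gt0 j : 0 < j <= n -> 0 < ed_ratio e j.
Proof.
move=> jn; have /andP[_ jn'] := jn.
have j1_le : j.-1 <= n by apply: leq_trans jn'; apply: leq_pred.
rewrite /ed_ratio divn_gt0; last exact: E_gt0.
by apply: dvdn_leq; [apply: E_gt0 | apply: E_dvdn].
Qed.

Lemma dvdn_ed_ratioP p j : prime p -> 0 < j <= n ->
  p %| ed_ratio e j <-> exists t, (0 < t <= logn p n) /\ j = pos p t.
Proof.
move=> p_pr jn; have /andP[j_gt0 j_le] := jn.
have j1_le : j.-1 <= n by apply: leq_trans j_le; apply: leq_pred.
rewrite -{1}(expn1 p) pfactor_dvdn ?(ed_ratio_gt0 jn) // logn_ed_ratio // subn_gt0.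
split=> [lt_log|[t [tn jE]]].
  (* For t = v_p(e_j) > v_p(e_(j-1)), the position of t is at most j but not at most j-1. *)
  exists (logn p (E j)).
  have tn : 0 < logn p (E j) <= logn p n.
    by rewrite logn_E_le // (leq_ltn_trans _ lt_log).
  split=> //; have := leq_logn_E p_pr tn j_le; have := leq_logn_E p_pr tn j1_le.
  by rewrite leqnn leqNgt lt_log /=; lia.
have := leq_logn_E p_pr tn j_le; have := leq_logn_E p_pr tn j1_le.
by rewrite -jE leqnn; lia.
Qed.

(** Positions increase strictly with t: if v_p(e_j) = s+2, then s+1 was already reached at j-1. *)
Lemma logn_ed_ratio_le1 p j : prime p -> 0 < j <= n -> logn p (ed_ratio e j) <= 1.
Proof.
move=> p_pr jn; have /andP[j_gt0 j_le] := jn.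
have j1_le : j.-1 <= n by apply: leq_trans j_le; apply: leq_pred.
rewrite logn_ed_ratio //; have := logn_E_le p_pr j_le.
move sE: (logn p (E j)) => s sn; case: s => [|[|s]] // in sE sn *; first by lia.
have s1 : 0 < s.+1 <= logn p n by rewrite (ltnW sn).
have := leq_logn_E p_pr (sn : 0 < s.+2 <= logn p n) j_le.
by have := leq_logn_E p_pr s1 j1_le; have := pos_lt p_pr sn; lia.
Qed.

(** A second prime q dividing the ratio would have a position equal to one of p, so q = p; and the
    exponent of p is at most 1. *)
Lemma ed_ratio_prime p j : prime p -> 0 < j <= n ->
  p %| ed_ratio e j -> ed_ratio e j = p.
Proof.
move=> p_pr jn pr; apply: eqn_from_log; rewrite ?(ed_ratio_gt0 jn) ?prime_gt0 //.
move=> q; rewrite (logn_prime q p_pr); have [q_pr|q_npr] := boolP (prime q); last first.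
  by rewrite lognE (negPf q_npr) /=; case: eqP => // qp; rewrite qp p_pr in q_npr.
have := logn_ed_ratio_le1 q_pr jn.
rewrite leq_eqVlt ltnS leqn0 => /orP[] /eqP lE; rewrite lE.
  have : q %| ed_ratio e j by rewrite -[q]expn1 pfactor_dvdn ?(ed_ratio_gt0 jn) ?lE.
  move=> /(dvdn_ed_ratioP q_pr jn)[t [tn jt]].
  have /(dvdn_ed_ratioP p_pr jn)[s [/andP[_ sn] js]] := pr.
  by have [-> _] := pos_inj q_pr p_pr tn sn (etrans (esym jt) js); rewrite eqxx.
case: eqP => // qp; move: pr; rewrite -qp -[q in q %| _]expn1 pfactor_dvdn ?(ed_ratio_gt0 jn) //.
by rewrite lE.
Qed.

Lemma ed_ratio_eqP p j : prime p -> 0 < j <= n ->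
  ed_ratio e j = p <-> exists t, (0 < t <= logn p n) /\ j = n - n %/ p ^ t + 1.
Proof.
move=> p_pr jn; split=> [rp|/(dvdn_ed_ratioP p_pr jn)]; last exact: ed_ratio_prime.
by apply/(dvdn_ed_ratioP p_pr jn); rewrite rp.
Qed.

Lemma perm_ed_ratio :
  perm_eq [seq ed_ratio e j | j <- iota 1 n]
          (flatten [seq nseq (logn p n) p | p <- primes n]
             ++ nseq (n - \sum_(p <- primes n) logn p n) 1).
Proof.
set r := [seq _ | j <- _]; set f := flatten _.
have Er : perm_eq [seq x <- r | x != 1] f.
  (* J lists the indices of the ratios other than 1, without repetition since positions are
     distinct; the ratio at [pos p t] is p. *)
  pose J := [seq pos p t | p <- primes n, t <- iota 1 (logn p n)].
  have -> : f = [seq ed_ratio e j | j <- J].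
    rewrite /J map_flatten -map_comp; congr flatten; apply/eq_in_map => p.
    rewrite mem_primes => /and3P[p_pr _ _] /=.
    rewrite -map_comp; apply: (@eq_from_nth _ 0); first by rewrite size_nseq size_map size_iota.
    rewrite size_nseq => i iN; rewrite nth_nseq iN (nth_map 0) ?size_iota // nth_iota //=.
    apply/esym/ed_ratio_eqP => //; last by exists (1 + i); rewrite iN.
    have := leq_div n (p ^ i.+1); rewrite /pos add1n.
    have : 0 < n %/ p ^ i.+1.
      by rewrite divn_gt0 ?expn_gt0 ?prime_gt0 // dvdn_leq // pfactor_dvdn.
    by lia.
  rewrite filter_map; apply: perm_map; apply: uniq_perm.
  - by rewrite filter_uniq ?iota_uniq.
  - apply: allpairs_uniq_dep => [|p _|]; [exact: primes_uniq | exact: iota_uniq |].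
    move=> [p s] [q t] /allpairsPdep[p' [s' [pP sP [-> ->]]]].
    move=> /allpairsPdep[q' [t' [qP tP [-> ->]]]] /= eq_pos.
    move: pP qP sP tP; rewrite !mem_primes !mem_iota !add1n !ltnS.
    move=> /and3P[p_pr _ _] /and3P[q_pr _ _] sP /andP[_ tP].
    by have [-> ->] := pos_inj p_pr q_pr sP tP eq_pos.
  move=> j; rewrite mem_filter mem_iota add1n ltnS /=.
  apply/andP/allpairsPdep => [[r1 jn]|[p [t [pP tP ->]]]].
    have p_pr : prime (pdiv (ed_ratio e j)).
      by rewrite pdiv_prime // ltn_neqAle eq_sym r1 (ed_ratio_gt0 jn).
    have /(dvdn_ed_ratioP p_pr jn)[t [tn jE]] := pdiv_dvd (ed_ratio e j).
    exists (pdiv (ed_ratio e j)), t; have /andP[t_gt0 t_le] := tn; split=> //.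
      by rewrite -logn_gt0 (leq_trans t_gt0).
    by rewrite mem_iota add1n ltnS.
  move: pP tP; rewrite mem_primes mem_iota add1n ltnS => /and3P[p_pr _ _] tP.
  have jn : 0 < pos p t <= n.
    rewrite /pos; have := leq_div n (p ^ t).
    have : 0 < n %/ p ^ t.
      rewrite divn_gt0 ?expn_gt0 ?prime_gt0 // dvdn_leq // pfactor_dvdn //.
      by case/andP: tP.
    by lia.
  split=> //; have /(ed_ratio_eqP p_pr jn) -> : exists t', (0 < t' <= logn p n) /\ pos p t = pos p t'.
    by exists t.
  by rewrite neq_ltn prime_gt1 ?orbT.
have Ef : size f = \sum_(p <- primes n) logn p n.
  by rewrite size_flatten sumnE !big_map; apply: eq_bigr => p _; rewrite size_nseq.
(* The remaining ratios all equal 1, and their number follows from the total n. *)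
rewrite -(perm_filterC (predC1 1)) perm_cat //.
have -> : [seq x <- r | predC (predC1 1) x] = nseq (count_mem 1 r) 1.
  rewrite (eq_filter (a2 := pred1 1)) => [|x]; last by rewrite /= negbK.
  by rewrite -size_filter; apply/all_pred1P; rewrite filter_all.
suff -> : count_mem 1 r = n - \sum_(p <- primes n) logn p n by [].
rewrite -Ef -(perm_size Er) size_filter.
have := count_predC (pred1 1) r; rewrite size_map size_iota => <-.
by rewrite addnK.
Qed.
End Ratios.

Theorem theorem2p19 (n : nat) (e : seq nat) :
  (0 < n)%N ->
  elementary_divisors (Amat n) e ->
  perm_eq [seq ed_ratio e j | j <- iota 1 n]
          (flatten [seq nseq (logn p n) p | p <- primes n]
             ++ nseq (n - \sum_(p <- primes n) logn p n) 1%N)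
  /\
  (forall j p, (1 <= j <= n)%N -> p \in primes n ->
     ed_ratio e j = p <->
     exists t, (1 <= t <= logn p n)%N /\ j = (n - n %/ p ^ t + 1)%N).
Proof.
move=> n_gt0 eP; have [e_size e_sorted _] := eP.
have eD := Amat_divisor_dvdn n_gt0 eP; have eN := Amat_divisor_ndvdn n_gt0 eP.
split; first exact: perm_ed_ratio.
move=> j p jn; rewrite mem_primes => /and3P[p_pr _ _].
exact: ed_ratio_eqP.
Qed.
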